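(* There is a polynomial-time algorithm that, given a clique $G$ on $n$ vertices and positive integers $\gamma_1,\gamma_2\le n$, either returns $|F|$, where $F\subseteq E(G)$ is a minimum-sized set of edges such that $(V(G),E(G)\setminus F)$ is a $(\gamma_1,\gamma_2)$-cardinality-constrained cluster graph, or correctly reports that no such set $F$ (of any size) exists.
   Context: A cluster graph is a graph in which every connected component is a clique. For integers $\gamma_1,\gamma_2\ge1$, a graph is $(\gamma_1,\gamma_2)$-cardinality-constrained if every connected component $H$ satisfies $\gamma_1\le|V(H)|\le\gamma_2$. *)

(* Defs.v *)
From mathcomp Require Import all_boot all_order all_algebra.

Set Implicit Arguments.
Unset Strict Implicit.
Unset Printing Implicit Defensive.

(** * Graphs *)

Record graph (V : finType) := Graph {
  edges : {set {set V}};
  edges_card2 : forall e, e \in edges -> #|e| = 2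
}.

Section Graph.
Variable V : finType.
Implicit Types (G : graph V) (F : {set {set V}}).

Definition adj G : rel V := [rel x y | [set x; y] \in edges G].

Fact del_edges_card2 G F e : e \in edges G :\: F -> #|e| = 2.
Proof. by case/setDP=> /edges_card2. Qed.

(* The graph (V(G), E(G) \ F). *)
Definition del_edges G F : graph V := Graph (@del_edges_card2 G F).

Fact adj_sym G : symmetric (adj G).
Proof. by move=> x y; rewrite /adj /= setUC. Qed.

(* As adj is symmetric, connect (adj G) is an equivalence relation; its classes
   are the vertex sets of the connected components of G. *)
Definition components G : {set {set V}} :=
  equivalence_partition (connect (adj G)) [set: V].

Definition clique_on G (H : {set V}) : Prop :=
  {in H &, forall x y, x != y -> adj G x y}.

Definition is_clique G : Prop := clique_on G [set: V].

Definition cluster_graph G : Prop :=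
  forall H, H \in components G -> clique_on G H.

Definition card_constrained (g1 g2 : nat) G : Prop :=
  forall H, H \in components G -> g1 <= #|H| <= g2.

Definition feasible G (g1 g2 : nat) F : Prop :=
  [/\ F \subset edges G,
      cluster_graph (del_edges G F)
    & card_constrained g1 g2 (del_edges G F)].

(* Some k: k is the minimum size of a feasible set; None: there is none. *)
Definition correct_answer G (g1 g2 : nat) (r : option nat) : Prop :=
  if r is Some k then
    (exists2 F, feasible G g1 g2 F & #|F| = k) /\
    (forall F, feasible G g1 g2 F -> k <= #|F|)
  else forall F, ~ feasible G g1 g2 F.

End Graph.

(** * Random access machines

   The random access machine of Cook and Reckhow (Time bounded random access
   machines, 1973), over natural numbers, under the logarithmic cost criterion:
   an instruction is charged the bit length of every address and every value
   that it handles.  Polynomial time on this machine is polynomial time on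
   Turing machines. *)

Inductive instr :=
| Const (i c : nat)   (* X_i := c *)
| Add (i j k : nat)   (* X_i := X_j + X_k *)
| Sub (i j k : nat)   (* X_i := X_j - X_k, truncated at 0 *)
| Fetch (i j : nat)   (* X_i := X_(X_j) *)
| Put (i j : nat)     (* X_(X_i) := X_j *)
| Jump (j l : nat)    (* if X_j > 0 then go to instruction l *)
| Read (i : nat)      (* X_i := next input number, or 0 if there is none left *)
| Emit (i : nat).     (* append X_i to the output *)

Definition program := seq instr.

Record config := Config {
  pc : nat;
  mem : nat -> nat;
  inp : seq nat;
  out : seq nat
}.

Definition init (x : seq nat) : config := Config 0 (fun=> 0) x [::].

Definition set_reg (m : nat -> nat) (i v : nat) : nat -> nat :=
  fun j => if j == i then v else m j.

Definition step (a : instr) (c : config) : config :=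
  let: Config q m x y := c in
  match a with
  | Const i k => Config q.+1 (set_reg m i k) x y
  | Add i j k => Config q.+1 (set_reg m i (m j + m k)) x y
  | Sub i j k => Config q.+1 (set_reg m i (m j - m k)) x y
  | Fetch i j => Config q.+1 (set_reg m i (m (m j))) x y
  | Put i j => Config q.+1 (set_reg m (m i) (m j)) x y
  | Jump j l => Config (if 0 < m j then l else q.+1) m x y
  | Read i => Config q.+1 (set_reg m i (head 0 x)) (behead x) y
  | Emit i => Config q.+1 m x (rcons y (m i))
  end.

(* The length of the binary representation of n; 0 has length 1. *)
Definition bitlen (n : nat) : nat := (trunc_log 2 n).+1.

Definition cost (a : instr) (c : config) : nat :=
  let m := mem c in
  match a with
  | Const i k => bitlen i + bitlen k
  | Add i j k | Sub i j k =>
      bitlen i + bitlen j + bitlen k + bitlen (m j) + bitlen (m k)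
  | Fetch i j => bitlen i + bitlen j + bitlen (m j) + bitlen (m (m j))
  | Put i j => bitlen i + bitlen j + bitlen (m i) + bitlen (m j)
  | Jump j l => bitlen j + bitlen l + bitlen (m j)
  | Read i => bitlen i + bitlen (head 0 (inp c))
  | Emit i => bitlen i + bitlen (m i)
  end.

(* exec P c t c': started in c, P halts in c' after a total cost t.  The machine
   halts when the program counter leaves the program. *)
Inductive exec (P : program) : config -> nat -> config -> Prop :=
| exec_halt c : onth P (pc c) = None -> exec P c 0 c
| exec_step c a t c' :
    onth P (pc c) = Some a -> exec P (step a c) t c' ->
    exec P c (cost a c + t) c'.

Definition outputs (P : program) (x : seq nat) (t : nat) (y : seq nat) : Prop :=
  exists2 c, exec P (init x) t c & out c = y.

Definition bitsize (x : seq nat) : nat := \sum_(v <- x) bitlen v.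

(** * Encodings *)

(* The number of vertices followed by the adjacency matrix, row by row. *)
Definition encode_graph (V : finType) (G : graph V) : seq nat :=
  #|V| :: [seq nat_of_bool (adj G x y) | x <- enum V, y <- enum V].

Definition encode_input (V : finType) (G : graph V) (g1 g2 : nat) : seq nat :=
  [:: g1, g2 & encode_graph G].

Definition encode_answer (r : option nat) : seq nat :=
  if r is Some k then [:: 1; k] else [:: 0].

(* Main.v *)
Require Import Defs.
From mathcomp Require Import all_boot all_order all_algebra.
From mathcomp Require Import zify.
(* The names Sub and mem of Defs are shadowed by those of mathcomp. *)
Import Defs.

Set Implicit Arguments.
Unset Strict Implicit.
Unset Printing Implicit Defensive.

(**
  Deleting a feasible set from a clique leaves a partition of the n vertices
  into blocks of sizes in [g1, g2], and conversely every such partition arises;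
  the surviving edges are the pairs inside the blocks.  Hence the answer is
  'C(n, 2) minus the maximum of the sum of the 'C(b, 2) over the lists of sizes
  b in [g1, g2] of sum n.  This maximum is computed by dynamic programming on
  n, choosing the first size of the list.

  The program takes O(n^2) steps.  Since a step at most doubles the largest
  value in memory, a run of k steps on an input of bit size w has logarithmic
  cost O(k * (w + k)), which makes any bound on the values superfluous.
*)

(** * Logarithmic cost of a run *)

Definition run (P : program) (k : nat) (c : config) : config :=
  iter k (fun c => if onth P (pc c) is Some a then step a c else c) c.

Lemma runD P j k c : run P (j + k) c = run P j (run P k c).
Proof. exact: iterD. Qed.

Definition instr_lt (b : nat) (a : instr) : bool :=
  match a with
  | Const i j | Fetch i j | Put i j | Jump i j => (i < b) && (j < b)
  | Add i j k | Sub i j k => [&& i < b, j < b & k < b]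
  | Read i | Emit i => i < b
  end.

Definition config_lt (b : nat) (c : config) : Prop :=
  (forall i, mem c i < b) /\ all (ltn^~ b) (inp c).

Lemma bitlen_le w v : 0 < w -> v < 2 ^ w -> bitlen v <= w.
Proof.
case: w => // w _ v_lt; rewrite /bitlen ltnS.
case: v v_lt => [|v] v_lt; first by rewrite trunc_log0.
by rewrite -ltnS -(ltn_exp2l _ _ (ltnSn 1)) (leq_ltn_trans (trunc_logP _ _)).
Qed.

(** The worst cases are [Add] and [Sub], charged for three addresses and two values: five bit
    lengths. *)
Lemma cost_le w a c :
  0 < w -> instr_lt (2 ^ w) a -> config_lt (2 ^ w) c -> cost a c <= 5 * w.
Proof.
move=> w0 a_lt [m_lt x_lt]; have bl v : v < 2 ^ w -> bitlen v <= w.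
  exact: bitlen_le.
have blm i : bitlen (mem c i) <= w by exact: bl.
have blx : bitlen (head 0 (inp c)) <= w.
  by apply: bl; case: (inp c) x_lt => [|v x] /=; [rewrite expn_gt0 | case/andP].
case: a a_lt => /= [i k|i j k|i j k|i j|i j|j l|i|i].
- by case/andP=> /bl ? /bl ?; lia.
- by case/and3P=> /bl ? /bl ? /bl ?; have := blm j; have := blm k; lia.
- by case/and3P=> /bl ? /bl ? /bl ?; have := blm j; have := blm k; lia.
- by case/andP=> /bl ? /bl ?; have := blm j; have := blm (mem c j); lia.
- by case/andP=> /bl ? /bl ?; have := blm i; have := blm j; lia.
- by case/andP=> /bl ? /bl ?; have := blm j; lia.
- by move=> /bl ?; lia.
- by move=> /bl ?; have := blm i; lia.
Qed.

Lemma step_lt b a c :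
  instr_lt b a -> config_lt b c -> config_lt (2 * b) (step a c).
Proof.
case: c => q m x y a_lt [/= m_lt x_lt].
have x_lt2 : all (ltn^~ (2 * b)) x.
  by apply: sub_all x_lt => v /=; lia.
have reg_lt i v : v < 2 * b -> forall j, set_reg m i v j < 2 * b.
  by move=> v_lt j; rewrite /set_reg; case: eqP => // _; have := m_lt j; lia.
have m_lt2 j : m j < 2 * b by have := m_lt j; lia.
case: a a_lt => /= [i k|i j k|i j k|i j|i j|j l|i|i] a_lt; split=> //=;
  try apply: reg_lt; try exact: m_lt2.
- by lia.
- by have := m_lt j; have := m_lt k; lia.
- by have := m_lt j; have := m_lt k; lia.
- by case: (x) x_lt2 => [|v x'] /= => [_|/andP[]//]; have := m_lt 0; lia.
- by case: (x) x_lt2 => [|v x'] //= /andP[].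
Qed.

(* Values at most double in one step, so a run of k steps only adds k to the
   bit length of the numbers that it handles. *)
Lemma exec_run P k w c :
  0 < w -> all (instr_lt (2 ^ w)) P -> config_lt (2 ^ w) c ->
  onth P (pc (run P k c)) = None ->
  exists2 t, exec P c t (run P k c) & t <= k * (5 * (w + k)).
Proof.
elim: k w c => [|k IHk] w c w0 P_lt c_lt.
  by exists 0 => //; exact: exec_halt.
rewrite /run iterSr -/(run P k _).
case Pa: (onth P (pc c)) => [a|] halted; last first.
  exists 0 => //; rewrite (_ : run P k c = c); first exact: exec_halt.
  by elim: (k) => //= j ->; rewrite Pa.
have a_lt : instr_lt (2 ^ w) a.
  elim: (P) (pc c) Pa P_lt => [|b Q IH] [|q] //=; first by case=> -> /andP[].
  by move=> /IH{}IH /andP[_]; apply: IH.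
have [||||t ex_t t_le] := IHk w.+1 (step a c) => //.
- by apply: sub_all P_lt => -[] /= *; rewrite expnS; lia.
- by rewrite expnS; exact: step_lt.
exists (cost a c + t); first exact: exec_step Pa ex_t.
have := @cost_le w a c w0 a_lt c_lt; nia.
Qed.

(** * Feasible sets and partitions of the vertex set *)

Definition kept_pairs (s : seq nat) : nat := \sum_(b <- s) 'C(b, 2).

Definition inner_pairs (V : finType) (P : {set {set V}}) : {set {set V}} :=
  [set e : {set V} | (#|e| == 2) && [exists B in P, e \subset B]].

(** The blocks are disjoint, so a pair lies inside at most one of them and the count splits over the
    blocks. *)
Lemma card_inner_pairs (V : finType) (P : {set {set V}}) :
  trivIset P -> #|inner_pairs P| = \sum_(B in P) 'C(#|B|, 2).
Proof.
move=> tiP; pose D (B : {set V}) := [set e : {set V} | e \subset B & #|e| == 2].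
(* The disjoint union used below ranges over all sets [B], hence the value [set0] outside [P]. *)
pose D' B := if B \in P then D B else set0.
have ->: inner_pairs P = \bigcup_B D' B.
  apply/setP=> e; rewrite inE; apply/andP/bigcupP.
    by case=> e2 /existsP[B /andP[PB eB]]; exists B; rewrite // /D' PB inE eB.
  case=> B _; rewrite /D'; case: ifP => PB; rewrite !inE // => /andP[eB ->].
  by split=> //; apply/existsP; exists B; rewrite PB.
rewrite -sum1_card partition_disjoint_bigcup => [|A B AB].
  rewrite [RHS]big_mkcond; apply: eq_bigr => B _; rewrite sum1_card /D'.
  by case: ifP => _; rewrite ?cards0 // cards_draws.
rewrite /D'; case: ifP => PA; last by rewrite disjoints_subset sub0set.
case: ifP => PB; last by rewrite disjoint_sym disjoints_subset sub0set.
apply/pred0P=> e /=; rewrite !inE; apply/negbTE; apply/negP.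
case/andP=> /andP[eA /cards2P[x [y [_ e_xy]]]] /andP[eB _].
have xe : x \in e by rewrite e_xy set21.
case/negP: AB; rewrite -(def_pblock tiP PA (subsetP eA x xe)).
by rewrite -(def_pblock tiP PB (subsetP eB x xe)).
Qed.

Lemma connect_adj_equiv (V : finType) (G : graph V) :
  {in [set: V] & &, equivalence_rel (connect (adj G))}.
Proof.
apply: in3W; apply/equivalence_relP; split=> [x | x y xy].
  exact: connect0.
exact/same_connect/xy/sym_connect_sym/adj_sym.
Qed.

Lemma components_partition (V : finType) (G : graph V) :
  partition (components G) [set: V].
Proof. exact/equivalence_partitionP/connect_adj_equiv. Qed.

Lemma mem_pblock_components (V : finType) (G : graph V) x y :
  (y \in pblock (components G) x) = connect (adj G) x y.
Proof. by apply: (pblock_equivalence_partition (@connect_adj_equiv V G)). Qed.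

Lemma edges_clique (V : finType) (G : graph V) :
  is_clique G -> edges G = [set e : {set V} | #|e| == 2].
Proof.
move=> clG; apply/setP=> e; rewrite inE; apply/idP/idP => [/edges_card2 -> //|].
by case/cards2P=> x [y [xy ->]]; apply: clG; rewrite ?inE.
Qed.

Lemma inner_pairs_subset (V : finType) (G : graph V) P :
  is_clique G -> inner_pairs P \subset edges G.
Proof.
by move=> clG; apply/subsetP=> e; rewrite (edges_clique clG) !inE; case/andP.
Qed.

Lemma cluster_edges (V : finType) (G : graph V) :
  cluster_graph G -> edges G = inner_pairs (components G).
Proof.
have /and3P[/eqP covG tiG _] := components_partition G.
move=> clG; apply/setP=> e; rewrite inE; apply/idP/idP => [Ge|].
  rewrite (edges_card2 Ge) eqxx /=.
  have /eqP/cards2P[x [y [_ e_xy]]] := edges_card2 Ge.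
  apply/existsP; exists (pblock (components G) x).
  rewrite pblock_mem ?covG //= e_xy subUset !sub1set !mem_pblock_components.
  by rewrite connect0 connect1 // /adj /= -e_xy.
case/andP=> /cards2P[x [y [xy ->]]] /existsP[H /andP[GH]].
by rewrite subUset !sub1set => /andP[Hx Hy]; apply: (clG H).
Qed.

Lemma card_feasible (V : finType) (G : graph V) g1 g2 F :
  is_clique G -> feasible G g1 g2 F ->
  #|F| = 'C(#|V|, 2) - \sum_(B in components (del_edges G F)) 'C(#|B|, 2).
Proof.
move=> clG [sFE cluF _].
have /and3P[_ tiP _] := components_partition (del_edges G F).
rewrite -card_inner_pairs // -cluster_edges // -card_draws.
rewrite -(edges_clique clG) /= cardsD (setIidPr sFE) subKn //.
exact: subset_leq_card.
Qed.

(** Lying in the same block is already transitive, so taking the connectivity closure adds nothing;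
    a partition is then recovered from its [pblock] function. *)
Lemma components_inner_pairs (V : finType) (G : graph V) P :
  partition P [set: V] -> edges G = inner_pairs P -> components G = P.
Proof.
move=> parP defG; have /and3P[/eqP covP tiP nP] := parP.
have adjE x y : adj G x y = (x != y) && (y \in pblock P x).
  rewrite /adj /= defG inE cards2; case: (eqVneq x y) => //= xy.
  apply/existsP/idP => [[B /andP[PB]]|yx].
    by rewrite subUset !sub1set => /andP[Bx By]; rewrite (def_pblock tiP PB Bx).
  exists (pblock P x); rewrite pblock_mem ?covP // subUset !sub1set yx.
  by rewrite mem_pblock covP inE.
have connE x y : connect (adj G) x y = (y \in pblock P x).
  apply/idP/idP => [/connectP[p xp ->]|yx]; last first.
    by case: (eqVneq x y) => [->|xy]; rewrite ?connect0 // connect1 // adjE xy.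
  elim: p x xp => [|z p IHp] x /=; first by rewrite mem_pblock covP inE.
  rewrite adjE => /andP[/andP[_ zx] /IHp].
  by rewrite (same_pblock tiP zx).
have /and3P[/eqP covG tiG nG] := components_partition G.
have pbE x : pblock (components G) x = pblock P x.
  by apply/setP=> y; rewrite mem_pblock_components connE.
apply/setP=> B; apply/idP/idP => [GB|PB].
  have /set0Pn[x Bx] : B != set0 by apply: contraNneq nG => <-.
  by rewrite -(def_pblock tiG GB Bx) pbE pblock_mem // covP.
have /set0Pn[x Bx] : B != set0 by apply: contraNneq nP => <-.
by rewrite -(def_pblock tiP PB Bx) -pbE pblock_mem // covG.
Qed.

Lemma feasible_of_partition (V : finType) (G : graph V) g1 g2 P :
  is_clique G -> partition P [set: V] ->
  {in P, forall B : {set V}, g1 <= #|B| <= g2} ->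
  feasible G g1 g2 (edges G :\: inner_pairs P) /\
  #|edges G :\: inner_pairs P| = 'C(#|V|, 2) - \sum_(B in P) 'C(#|B|, 2).
Proof.
move=> clG parP szP; set F := _ :\: _.
have defE : edges (del_edges G F) = inner_pairs P.
  by rewrite /= /F setDDr setDv set0U (setIidPr (inner_pairs_subset P clG)).
have defP := components_inner_pairs parP defE.
have feasF : feasible G g1 g2 F.
  split; first exact: subsetDl;
    rewrite ?/cluster_graph ?/card_constrained defP //.
  move=> B PB x y Bx By xy.
  suff : [set x; y] \in edges (del_edges G F) by [].
  rewrite defE inE cards2 xy /=; apply/existsP; exists B.
  by rewrite PB subUset !sub1set Bx.
by rewrite (card_feasible clG feasF) defP.
Qed.

(** Blocks are carved out of [A] one at a time. Sizes are positive because a partition has no empty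
    block. *)
Lemma partition_of_sizes (V : finType) (A : {set V}) (s : seq nat) :
  all (leq 1) s -> sumn s = #|A| ->
  exists P : {set {set V}}, [/\ partition P A,
    {in P, forall B : {set V}, #|B| \in s}
    & \sum_(B in P) 'C(#|B|, 2) = kept_pairs s].
Proof.
elim: s A => [|b s IHs] A /=.
  move=> _ /esym/cards0_eq ->; exists set0; split.
  - apply/and3P; split; rewrite ?inE ?/cover ?big_set0 //.
    by apply/trivIsetP=> B C; rewrite inE.
  - by move=> B; rewrite inE.
  - by rewrite /kept_pairs big_set0 big_nil.
case/andP=> b0 s0 sumA.
have /set0Pn[B] : [set B : {set V} | B \subset A & #|B| == b] != set0.
  by rewrite -card_gt0 cards_draws bin_gt0 -sumA leq_addr.
rewrite inE => /andP[BA /eqP Bb].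
have [|P [parP szP wP]] := IHs (A :\: B) s0.
  by rewrite cardsD (setIidPr BA) Bb -sumA addKn.
(* Otherwise [B] would lie in [A :\: B], hence be empty. This lets the sum over [B |: P] count [B]
   separately. *)
have PB : B \notin P.
  apply/negP=> PB; have : B \subset cover P by exact: bigcup_sup.
  rewrite (cover_partition parP) subsetD => /andP[_ dB].
  by move: b0; rewrite -Bb card_gt0 -setI_eq0 setIid in dB *; rewrite dB.
exists (B |: P); split.
- rewrite -(setID A B) (setIidPr BA); apply: partitionU1 => //.
    by rewrite -card_gt0 Bb.
  by rewrite -setI_eq0 setIDA setIC setDIl setDv setI0 // set0I.
- by move=> C; rewrite !inE => /orP[/eqP->|/szP ->]; rewrite ?Bb ?eqxx ?orbT.
- by rewrite big_setU1 //= wP /kept_pairs big_cons Bb.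
Qed.

Definition size_list (g1 g2 m : nat) (s : seq nat) : bool :=
  (sumn s == m) && all (fun b => g1 <= b <= g2) s.

Lemma size_list_feasible (V : finType) (G : graph V) g1 g2 s :
  is_clique G -> 0 < g1 -> size_list g1 g2 #|V| s ->
  exists2 F, feasible G g1 g2 F & #|F| = 'C(#|V|, 2) - kept_pairs s.
Proof.
move=> clG g1_gt0 /andP[/eqP sumV sz_s].
have [||P [parP szP wP]] := @partition_of_sizes V [set: V] s.
- by apply: sub_all sz_s => b /andP[/(leq_trans g1_gt0)].
- by rewrite cardsT.
have szP' : {in P, forall B : {set V}, g1 <= #|B| <= g2}.
  by move=> B /szP /(allP sz_s).
have [feasF cardF] := feasible_of_partition clG parP szP'.
by exists (edges G :\: inner_pairs P); rewrite // cardF wP.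
Qed.

Lemma feasible_size_list (V : finType) (G : graph V) g1 g2 F :
  is_clique G -> feasible G g1 g2 F ->
  exists2 s, size_list g1 g2 #|V| s & #|F| = 'C(#|V|, 2) - kept_pairs s.
Proof.
move=> clG feasF; have parP := components_partition (del_edges G F).
exists [seq #|B| | B : {set V} <- enum (components (del_edges G F))]; last first.
  by rewrite (card_feasible clG feasF) /kept_pairs big_map big_enum.
apply/andP; split.
  by rewrite sumnE big_map big_enum -(card_partition parP) cardsT.
case: feasF => _ _ szF; apply/allP=> _ /mapP[B + ->].
by rewrite mem_enum; exact: szF.
Qed.

(** * Dynamic programming *)

(* v is the maximum of 0 and of the (kept_pairs s).+1, for s a list of sizes of
   sum m whose first size is at most b; thus v = 0 if there is no such list. *)
Definition best_value (g1 g2 m b v : nat) : Prop :=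
  (0 < v -> exists s, [/\ size_list g1 g2 m s, head 0 s <= b
                        & v = (kept_pairs s).+1]) /\
  (forall s, size_list g1 g2 m s -> head 0 s <= b -> kept_pairs s < v).

Lemma kept_pairs_cons b s : kept_pairs (b :: s) = 'C(b, 2) + kept_pairs s.
Proof. exact: big_cons. Qed.

Lemma size_list_cons g1 g2 m b s :
  size_list g1 g2 m (b :: s) =
  [&& b <= m, g1 <= b <= g2 & size_list g1 g2 (m - b) s].
Proof.
rewrite /size_list /=; case: (leqP b m) => /= bm.
  by rewrite -{1}(subnKC bm) eqn_add2l andbCA.
by apply/negbTE/negP => /andP[/eqP]; lia.
Qed.

Lemma best_value_nil g1 g2 : 0 < g1 -> best_value g1 g2 0 0 1.
Proof.
move=> g1_gt0; split=> [_|[|b s]].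
- by exists [::]; rewrite /kept_pairs big_nil.
- by rewrite /kept_pairs big_nil.
- by rewrite size_list_cons; lia.
Qed.

Lemma best_value_start g1 g2 m : 0 < g1 -> 0 < m -> best_value g1 g2 m 0 0.
Proof.
move=> g1_gt0 m_gt0; split=> // -[|b s]; first by rewrite /size_list /=; lia.
by rewrite size_list_cons /=; lia.
Qed.

Lemma head_size_list g1 g2 m s : size_list g1 g2 m s -> head 0 s <= m.
Proof. by case: s => [|b s] //; rewrite size_list_cons => /and3P[]. Qed.

Lemma best_value_out g1 g2 m b v :
  ~~ (g1 <= b.+1 <= g2) -> best_value g1 g2 m b v -> best_value g1 g2 m b.+1 v.
Proof.
move=> b_out [ex_v max_v]; split=> [/ex_v[s [sz_s hd_s v_s]]|].
  by exists s; split=> //; exact: leqW.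
case=> [|c s] sz_s; first by move=> _; exact: max_v.
rewrite leq_eqVlt => /orP[/eqP /= c_b|]; last exact: max_v.
by move: sz_s; rewrite size_list_cons c_b (negbTE b_out) andbF.
Qed.

(** A new list starts with [b.+1], and its tail is any list of sum [m - b.+1], whose first size
    cannot exceed that sum. The test [0 < u] is required since 0 encodes the absence of a tail. *)
Lemma best_value_step g1 g2 m b u v :
  b < m -> g1 <= b.+1 <= g2 -> best_value g1 g2 (m - b.+1) (m - b.+1) u ->
  best_value g1 g2 m b v ->
  best_value g1 g2 m b.+1 (if 0 < u then maxn v (u + 'C(b.+1, 2)) else v).
Proof.
move=> bm b_in [ex_u max_u] [ex_v max_v].
have ex_v' : 0 < v -> exists s, [/\ size_list g1 g2 m s, head 0 s <= b.+1
                                  & v = (kept_pairs s).+1].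
  by move=> /ex_v[s [sz_s hd_s ->]]; exists s; split=> //; exact: leqW.
split=> [|[|c s] sz_s].
- case: ifP => [/ex_u[s [sz_s _ ->]]|_]; last exact: ex_v'.
  case: (leqP v (_ + _)) => _; last exact: ex_v'.
  move=> _; exists (b.+1 :: s); split=> //.
    by rewrite size_list_cons bm b_in.
  by rewrite kept_pairs_cons addnC addnS.
- have := max_v _ sz_s isT; case: ifP => // _; rewrite leq_max => -> //.
- rewrite leq_eqVlt => /orP[/eqP /= c_b|].
    move: sz_s; rewrite size_list_cons c_b => /and3P[_ _ sz_s].
    have lt_u := max_u s sz_s (head_size_list sz_s).
    rewrite ifT ?kept_pairs_cons ?leq_max; last exact: leq_trans lt_u.
    by apply/orP; right; lia.
  by move/(max_v _ sz_s) => lt_v; case: ifP => // _; rewrite leq_max lt_v.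
Qed.

(* X_1, X_2, X_3 hold g1, g2, n, and X_(20 + j) is such that
   best_value g1 g2 j j X_(20 + j).
   The outer loop (at 6) increments j = X_4; the inner loop (at 13) increments
   the first size s = X_5, with X_6 = 'C(s, 2) and X_7 the maximum over the
   first sizes at most s; X_0 = 0, X_9 = 1, X_10 = 20 are constant.  At the end
   (at 33), X_6 = 'C(n, 2). *)
Definition clique_program : program :=
  [:: Read 1; Read 2; Read 3; Const 9 1; Const 10 20; Put 10 9;
   Sub 8 3 4; Jump 8 9; Jump 9 33;
   Add 4 4 9; Const 5 0; Const 6 0; Const 7 0;
   Sub 8 4 5; Jump 8 18; Add 11 10 4; Put 11 7; Jump 9 6;
   Add 6 6 5; Add 5 5 9; Sub 8 1 5; Jump 8 13; Sub 8 5 2; Jump 8 13;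
   Sub 8 4 5; Add 8 10 8; Fetch 12 8; Sub 8 9 12; Jump 8 13;
   Add 12 12 6; Sub 8 12 7; Add 7 7 8; Jump 9 13;
   Add 11 10 3; Fetch 7 11; Jump 7 38; Emit 0; Jump 9 42;
   Sub 7 7 9; Sub 7 6 7; Emit 9; Emit 7].

(** * Execution of the program and its loop invariants *)

Lemma run_instr P k q m x y a :
  onth P q = Some a ->
  run P k.+1 (Config q m x y) = run P k (step a (Config q m x y)).
Proof. by rewrite /run iterSr /= => ->. Qed.

Lemma set_regE m i v j : set_reg m i v j = if j == i then v else m j.
Proof. by []. Qed.

Arguments set_reg : simpl never.
Arguments run : simpl never.

(** The table starts at register 20, so its cells never collide with the working registers. *)
Lemma table_reg j i : i < 20 -> (20 + j == i) = false.
Proof. by move=> i_lt; apply/eqP; lia. Qed.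

Record frame g1 g2 n i (m : nat -> nat) : Prop := Frame {
  frame0 : m 0 = 0; frame1 : m 1 = g1; frame2 : m 2 = g2; frame3 : m 3 = n;
  frame4 : m 4 = i; frame9 : m 9 = 1; frame10 : m 10 = 20 }.

Definition table g1 g2 i (m : nat -> nat) : Prop :=
  forall j, j < i -> best_value g1 g2 j j (m (20 + j)).

Record inner_inv g1 g2 n i s (m : nat -> nat) : Prop := InnerInv {
  inner_frame : frame g1 g2 n i m;
  inner5 : m 5 = s;
  inner6 : m 6 = 'C(s, 2);
  inner7 : best_value g1 g2 i s (m 7);
  inner_table : table g1 g2 i m }.

Ltac ram :=
  lazymatch goal with |- run _ _ (Config ?q ?m ?x ?y) = _ =>
    lazymatch eval vm_compute in (onth clique_program q) with Some ?a =>
      rewrite (@run_instr clique_program _ q m x y a erefl) /= ?set_regE /=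
    end
  end.

Lemma inner_step g1 g2 n i s m x y :
  s < i -> inner_inv g1 g2 n i s m ->
  exists k m', [/\ k <= 20,
    run clique_program k (Config 13 m x y) = Config 13 m' x y
    & inner_inv g1 g2 n i s.+1 m'].
Proof.
move=> si [[m0 m1 m2 m3 m4 m9 m10] m5 m6 best7 tab].
have s_gt0 : 0 < i - s by rewrite subn_gt0.
(* The machine has no multiplication; Pascal's rule updates the binomial by one addition. *)
have bins : 'C(s, 2) + s = 'C(s.+1, 2) by rewrite binS bin1.
(* The loop body has four ways back to 13: size too small, size too large, no list for the
   remainder, and an update of the maximum. They take 6, 8, 13 and 17 instructions. *)
case: (ltnP s.+1 g1) => g1s.
  exists 6; eexists; split; first by [].
    do 2 ram; rewrite m4 m5 s_gt0.
    do 4 ram; rewrite m1 m5 m6 m9 bins addn1 subn_gt0 g1s; reflexivity.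
  split; first (by split); rewrite ?set_regE //=.
  by apply: best_value_out best7; rewrite leqNgt g1s.
case: (ltnP g2 s.+1) => g2s.
  exists 8; eexists; split; first by [].
    do 2 ram; rewrite m4 m5 s_gt0.
    do 4 ram; rewrite m1 m5 m6 m9 bins addn1 subn_gt0 ltnNge g1s /=.
    do 2 ram; rewrite m2 subn_gt0 g2s; reflexivity.
  split; first (by split); rewrite ?set_regE //=.
  by apply: best_value_out best7; rewrite g1s leqNgt g2s.
have lt_i : i - s.+1 < i by rewrite ltn_subrL (leq_ltn_trans _ si).
have s_in : g1 <= s.+1 <= g2 by rewrite g1s.
have := best_value_step si s_in (tab _ lt_i) best7.
case: (posnP (m (20 + (i - s.+1)))) => [u0|u_gt0] best'.
  exists 13; eexists; split; first by [].
    do 2 ram; rewrite m4 m5 s_gt0.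
    do 4 ram; rewrite m1 m5 m6 m9 bins addn1 subn_gt0 ltnNge g1s /=.
    do 2 ram; rewrite m2 subn_gt0 ltnNge g2s /=.
    do 5 ram; rewrite m4 m9 m10 !table_reg // u0; reflexivity.
  by split; first (by split); rewrite ?set_regE //=.
have u0 : 1 - m (20 + (i - s.+1)) = 0 by apply/eqP; rewrite subn_eq0.
exists 17; eexists; split; first by [].
  do 2 ram; rewrite m4 m5 s_gt0.
  do 4 ram; rewrite m1 m5 m6 m9 bins addn1 subn_gt0 ltnNge g1s /=.
  do 2 ram; rewrite m2 subn_gt0 ltnNge g2s /=.
  do 5 ram; rewrite m4 m9 m10 !table_reg // u0 /=.
  do 4 ram; rewrite m9; reflexivity.
split; first (by split); rewrite ?set_regE //=.
(* Truncated subtraction yields the maximum: [v + (w - v)] is [maxn v w]. *)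
by rewrite -maxnE.
Qed.

Lemma inner_loop g1 g2 n d s m x y :
  inner_inv g1 g2 n (s + d) s m ->
  exists k m', [/\ k <= 20 * d,
    run clique_program k (Config 13 m x y) = Config 13 m' x y
    & inner_inv g1 g2 n (s + d) (s + d) m'].
Proof.
elim: d s m => [|d IHd] s m inv_m; first by exists 0, m; rewrite {2}addn0.
have [|k1 [m1 [le_k1 run1 inv1]]] := inner_step x y _ inv_m.
  by rewrite -addSnnS leq_addr.
rewrite -addSnnS in inv1 *; have [k2 [m2 [le_k2 run2 inv2]]] := IHd _ _ inv1.
by exists (k2 + k1), m2; split; [lia | rewrite runD run1 | ].
Qed.

(** The inner loop leaves its last binomial in [X_6]; at [i = n] this is the number of edges of the
    clique. *)
Record outer_inv g1 g2 n i (m : nat -> nat) : Prop := OuterInv {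
  outer_frame : frame g1 g2 n i m;
  outer6 : m 6 = 'C(i, 2);
  outer_table : table g1 g2 i.+1 m }.

Lemma outer_step g1 g2 n i m x y :
  0 < g1 -> i < n -> outer_inv g1 g2 n i m ->
  exists k m', [/\ k <= 20 * n + 11,
    run clique_program k (Config 6 m x y) = Config 6 m' x y
    & outer_inv g1 g2 n i.+1 m'].
Proof.
move=> g1_gt0 i_lt [[m0 m1 m2 m3 m4 m9 m10] m6 tab].
have [m' run1 inv1] : exists2 m',
    run clique_program 6 (Config 6 m x y) = Config 13 m' x y
    & inner_inv g1 g2 n (0 + i.+1) 0 m'.
  eexists.
    do 2 ram; rewrite m3 m4 subn_gt0 i_lt.
    do 4 ram; rewrite m4 m9 addn1; reflexivity.
  split; first (by split); rewrite ?set_regE //=.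
  exact: best_value_start.
have [k [m2' [le_k run2 inv2]]] := inner_loop x y inv1.
rewrite add0n in le_k inv2.
have [[p0 p1 p2 p3 p4 p9 p10] p5 p6 best7 tab7] := inv2.
(* Six instructions enter the inner loop, and five leave it and store the new table entry. *)
exists (5 + (k + 6)).
exists (set_reg (set_reg (set_reg m2' 8 0) 11 (20 + i.+1)) (20 + i.+1) (m2' 7)).
split; first by lia.
  rewrite runD [run _ (k + 6) _]runD run1 run2.
  do 2 ram; rewrite p4 p5 subnn /=.
  by do 3 ram; rewrite p4 p9 p10 ?table_reg.
split=> [||j]; first split; rewrite ?set_regE //=.
rewrite ltnS leq_eqVlt eqn_add2l; case: eqP => [-> //|_] /= ji; exact: tab7.
Qed.

Lemma outer_loop g1 g2 d i m x y :
  0 < g1 -> outer_inv g1 g2 (i + d) i m ->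
  exists k m', [/\ k <= (20 * (i + d) + 11) * d,
    run clique_program k (Config 6 m x y) = Config 6 m' x y
    & outer_inv g1 g2 (i + d) (i + d) m'].
Proof.
move=> g1_gt0; elim: d i m => [|d IHd] i m inv_m.
  by exists 0, m; rewrite muln0 {2}addn0.
have [|k1 [m1 [le_k1 run1 inv1]]] := outer_step x y g1_gt0 _ inv_m.
  by rewrite -addSnnS leq_addr.
rewrite -[i + d.+1]addSnnS in le_k1 inv1 *.
have [k2 [m2 [le_k2 run2 inv2]]] := IHd _ _ inv1.
by exists (k2 + k1), m2; split; [nia | rewrite runD run1 | ].
Qed.

Definition answer (n v : nat) : option nat :=
  if 0 < v then Some ('C(n, 2) - v.-1) else None.

Lemma clique_program_run g1 g2 n x :
  0 < g1 -> exists k v, [/\ k <= 20 * n ^ 2 + 11 * n + 20,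
    best_value g1 g2 n n v,
    onth clique_program
      (pc (run clique_program k (init [:: g1, g2, n & x]))) = None
    & out (run clique_program k (init [:: g1, g2, n & x])) =
      encode_answer (answer n v)].
Proof.
move=> g1_gt0.
have [m run1 inv1] : exists2 m,
    run clique_program 6 (init [:: g1, g2, n & x]) = Config 6 m x [::]
    & outer_inv g1 g2 (0 + n) 0 m.
  eexists; first by rewrite /init; do 6 ram; reflexivity.
  split=> [||j]; first split; rewrite ?set_regE //.
  (* The only entry so far is [X_20 = 1], for the empty list. *)
  by rewrite ltnS leqn0 => /eqP ->; exact: best_value_nil.
have [k [m' [le_k run2 inv2]]] := outer_loop x [::] g1_gt0 inv1.
rewrite add0n in le_k inv2.
have [[p0 p1 p2 p3 p4 p9 p10] p6 tab] := inv2.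
have [m2 run3 [e6 e7 e9 e0]] : exists2 m2,
    run clique_program 5 (Config 6 m' x [::]) = Config 35 m2 x [::]
    & [/\ m2 6 = 'C(n, 2), m2 7 = m' (20 + n), m2 9 = 1 & m2 0 = 0].
  eexists.
    do 2 ram; rewrite p3 p4 subnn /=.
    do 1 ram; rewrite p9 /=.
    do 2 ram; rewrite p3 p10 ?table_reg //; reflexivity.
  by rewrite !set_regE.
pose v := m' (20 + n).
(* The program has 42 instructions, so reaching 42 means halting. [X_0] and [X_9] supply the answer
   tags 0 and 1. *)
have [k4 [m3 [le_k4 run4]]] : exists k4 m3, k4 <= 5 /\
    run clique_program k4 (Config 35 m2 x [::]) =
    Config 42 m3 x (encode_answer (answer n v)).
  rewrite /answer; case: posnP => v0.
    exists 3; eexists; split; first by [].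
    by ram; rewrite e7 -/v v0 /=; do 2 ram; rewrite e0 e9; reflexivity.
  exists 5; eexists; split; first by [].
  ram; rewrite e7 -/v v0 /=; do 4 ram; rewrite e6 e7 e9 -/v subn1; reflexivity.
exists (k4 + (5 + (k + 6))), v.
rewrite !runD run1 run2 run3 run4; split=> //; last exact: tab.
by rewrite expnS expn1; nia.
Qed.

(** * Correctness of the answer and the polynomial bound *)

Lemma answer_correct (V : finType) (G : graph V) g1 g2 v :
  is_clique G -> 0 < g1 -> best_value g1 g2 #|V| #|V| v ->
  correct_answer G g1 g2 (answer #|V| v).
Proof.
move=> clG g1_gt0 [ex_v max_v].
have le_v F : feasible G g1 g2 F -> 0 < v /\ 'C(#|V|, 2) - v.-1 <= #|F|.
  case/(feasible_size_list clG) => s sz_s ->.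
  by have := max_v s sz_s (head_size_list sz_s); split; lia.
rewrite /answer; case: posnP => [v0 F /le_v[]|/ex_v[s [sz_s _ v_s]] /=].
  by rewrite v0.
split=> [|F /le_v[] //]; rewrite v_s; exact: size_list_feasible.
Qed.

Lemma bitlen_lt v : v < 2 ^ bitlen v.
Proof. exact: trunc_log_ltn. Qed.

Lemma bitsize_ge x : size x <= bitsize x.
Proof. by rewrite /bitsize -sum1_size; apply: leq_sum. Qed.

Lemma init_lt w x : bitsize x <= w -> config_lt (2 ^ w) (init x).
Proof.
move=> x_le; split=> [i|]; first by rewrite /= expn_gt0.
apply/allP=> v xv /=; apply: leq_trans (bitlen_lt v) _; rewrite leq_exp2l //.
by apply: leq_trans x_le; rewrite /bitsize (big_rem v xv) /= leq_addr.
Qed.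

Theorem mainTheorem14 :
  exists (A : program) (p : {poly nat}),
    forall (V : finType) (G : graph V) (g1 g2 : nat),
      is_clique G -> 0 < g1 <= #|V| -> 0 < g2 <= #|V| ->
      exists (r : option nat) (t : nat),
        [/\ outputs A (encode_input G g1 g2) t (encode_answer r),
            t <= (p.[bitsize (encode_input G g1 g2)])%R
          & correct_answer G g1 g2 r].
Proof.
(* With [N] the bit size, [k <= 31 * N] and [N + 6 + k <= 34 * N] as [3 <= N]; the cost
   [k * (5 * (N + 6 + k))] is then at most [155 * 34 * N ^ 2]. *)
exists clique_program, ('X^2 *+ (155 * 34))%R.
move=> V G g1 g2 clG /andP[g1_gt0 _] _.
set x := encode_input G g1 g2.
(* The input lists the matrix and three further numbers, each of bit length at least 1. So
   quadratically many steps in [#|V|] are linear in the bit size. *)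
have V_le : #|V| ^ 2 + 3 <= bitsize x.
  by apply: leq_trans (bitsize_ge x); rewrite /= size_allpairs -cardE; lia.
have [k [v [le_k best_v halted out_v]]] :=
  @clique_program_run g1 g2 #|V| (behead (encode_graph G)) g1_gt0.
have [||||t ex_t t_le] := @exec_run clique_program k (bitsize x + 6) (init x).
- by rewrite addnS.
(* All constants, addresses and jump targets of the program are below 64, whence the summand 6. *)
- have: all (instr_lt (2 ^ 6)) clique_program by [].
  have: 2 ^ 6 <= 2 ^ (bitsize x + 6) by rewrite leq_exp2l // leq_addl.
  move: (2 ^ 6) (2 ^ _) => a b ab; apply: sub_all => -[] /= *; lia.
- by apply: init_lt; exact: leq_addr.
- exact: halted.
exists (answer #|V| v), t; split; last exact: answer_correct.
  by exists (run clique_program k (init x)).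
have k_le : k <= 31 * bitsize x by apply: leq_trans le_k _; nia.
rewrite hornerMn hornerXn -GRing.mulr_natr !natrE.
apply: leq_trans t_le _; nia.
Qed.
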